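(* For a ring $A$, the following are equivalent: (1) $A$ is a right non-singular ring and every automorphism-invariant non-singular right $A$-module is injective; (2) $A$ is a right strongly semiprime ring.
   Context: All modules are unitary right modules. A module $M$ is automorphism-invariant if $M$ is invariant under every automorphism of its injective hull. A right $A$-module $X$ is non-singular if there is no nonzero $x\in X$ whose right annihilator $r(x)$ is an essential right ideal of $A$; $A$ is right non-singular if $A_A$ is non-singular. A ring $R$ is right strongly semiprime if every two-sided ideal of $R$ that is essential as a right ideal contains a finite subset whose right annihilator in $R$ is zero. *)

(* Defs.v *)
(* Right A-modules are modelled as left modules over the
   converse ring A^c: for M : lmodType A^c, the right action m.a is a *: m,
   and (m.b).a = a *: (b *: m) = (b *_A a)... i.e. m.(b a) = (m.b).a. *)
From HB Require Import structures.
From mathcomp Require Import all_boot all_order all_algebra.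
Set Implicit Arguments. Unset Strict Implicit. Unset Printing Implicit Defensive.
Import GRing.Theory.
Local Open Scope ring_scope.

Section Defs.
Variable A : pzRingType.
Notation rmod := (lmodType A^c).

Definition ract (M : rmod) (x : M) (a : A) : M := (a : A^c) *: x.

Definition is_hom (M N : rmod) (f : M -> N) : Prop :=
  (forall x y : M, f (x + y) = f x + f y) /\
  (forall (x : M) (a : A), f (ract x a) = ract (f x) a).

Definition submod (M : rmod) (S : M -> Prop) : Prop :=
  S 0 /\ (forall x y, S x -> S y -> S (x + y)) /\
  (forall x a, S x -> S (ract x a)).

Definition essential (M : rmod) (S : M -> Prop) : Prop :=
  submod S /\
  forall N : M -> Prop, submod N -> (exists x, N x /\ x <> 0) ->
    exists x, N x /\ S x /\ x <> 0.

Definition right_ideal (I : A -> Prop) : Prop :=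
  I 0 /\ (forall x y, I x -> I y -> I (x + y)) /\
  (forall x a, I x -> I (x * a)).

Definition essential_right_ideal (I : A -> Prop) : Prop :=
  right_ideal I /\
  forall J : A -> Prop, right_ideal J -> (exists x, J x /\ x <> 0) ->
    exists x, J x /\ I x /\ x <> 0.

Definition two_sided_ideal (I : A -> Prop) : Prop :=
  right_ideal I /\ (forall a x, I x -> I (a * x)).

Definition rann (M : rmod) (x : M) : A -> Prop := fun a => ract x a = 0.

Definition nonsingular_module (M : rmod) : Prop :=
  forall x : M, x <> 0 -> ~ essential_right_ideal (rann x).

Definition right_nonsingular : Prop :=
  forall x : A, x <> 0 -> ~ essential_right_ideal (fun a => x * a = 0).

Definition injective_module (E : rmod) : Prop :=
  forall (M N : rmod) (f : M -> N) (g : M -> E),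
    is_hom f -> injective f -> is_hom g ->
    exists h : N -> E, is_hom h /\ forall x, h (f x) = g x.

Definition injective_hull (M E : rmod) (i : M -> E) : Prop :=
  is_hom i /\ injective i /\ injective_module E /\
  essential (fun y : E => exists x, y = i x).

Definition automorphism_invariant (M : rmod) : Prop :=
  forall (E : rmod) (i : M -> E), injective_hull i ->
    forall f : E -> E, is_hom f -> bijective f ->
      forall x : M, exists y : M, f (i x) = i y.

Definition right_strongly_semiprime : Prop :=
  forall I : A -> Prop, two_sided_ideal I -> essential_right_ideal I ->
    exists s : seq A, (forall x, x \in s -> I x) /\
      (forall a : A, (forall x, x \in s -> x * a = 0) -> a = 0).

End Defs.

(* Main.v *)
Require Import Defs.
From HB Require Import structures.
From mathcomp Require Import all_boot all_order all_algebra.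
From mathcomp Require Import boolp classical_sets.

(* (1) => (2): given an ideal I, the elements y of the injective hull E(A) with
   r(s) <= r(y) for some finite s in I form a fully invariant essential submodule; it is
   injective, hence equal to E(A), and the element 1 yields s with r(s) = 0.

   (2) => (1): A is semiprime and right non-singular.  Let P be an essential submodule of
   an injective non-singular module E, stable under the units of S = End(E).  Strong
   semiprimeness provides finitely many m_i in P with r(m) <= r(y) for all y in the
   closure of P; so the closure of a fully invariant P lies in the sum of the S m_i, that
   is, in P.  In particular the largest fully invariant P0 <= P is a direct summand e E;
   put f = 1 - e.  The stabiliser T of P is a subring of the regular ring S containing
   all units, and f v = 0 whenever S v <= T.  As 1 + g v (1 - g) is a unit for g
   idempotent, the ideal generated by all g S (1 - g) lies in T, so idempotents become
   central in f S; splitting elements into units of corners also puts the ideal of all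
   s^2 - s in T, so f S is a Boolean ring.  An atom s of f S would give s E <= P0, and if
   f S is atomless a strictly decreasing chain of idempotents c_n gives a fully invariant
   submodule, the union of the kernels of the c_n, that is not contained in a single
   kernel, against the finiteness statement.  Hence f = 0 and P = E. *)

Set Implicit Arguments. Unset Strict Implicit. Unset Printing Implicit Defensive.
Import GRing.Theory.
Local Open Scope ring_scope.

Local Notation "x *> a" := (ract x a) (at level 40, left associativity).

(** * Essential submodules and injectivity *)

Section Modules.
Variable A : pzRingType.
Local Notation rmod := (lmodType A^c).
Implicit Types (M N E : rmod) (I J : A -> Prop).

Lemma ractD M (x y : M) a : (x + y) *> a = x *> a + y *> a.
Proof. exact: scalerDr. Qed.

Lemma ractDr M (x : M) a b : x *> (a + b) = x *> a + x *> b.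
Proof. exact: scalerDl. Qed.

Lemma ractM M (x : M) a b : x *> (a * b) = x *> a *> b.
Proof. by rewrite /ract scalerA. Qed.

Lemma ract0 M a : (0 : M) *> a = 0.
Proof. exact: scaler0. Qed.

Lemma ractr0 M (x : M) : x *> 0 = 0.
Proof. exact: scale0r. Qed.

Lemma ract1 M (x : M) : x *> 1 = x.
Proof. exact: scale1r. Qed.

Lemma ractN M (x : M) a : (- x) *> a = - (x *> a).
Proof. exact: scalerN. Qed.

Lemma ractB M (x y : M) a : (x - y) *> a = x *> a - y *> a.
Proof. by rewrite ractD ractN. Qed.

Section Homs.
Variables (M N : rmod) (f : M -> N).
Hypothesis hf : is_hom f.

Lemma homD x y : f (x + y) = f x + f y. Proof. exact: (proj1 hf). Qed.
Lemma homZ x a : f (x *> a) = f x *> a. Proof. exact: (proj2 hf). Qed.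
Lemma hom0 : f 0 = 0. Proof. by rewrite -(ractr0 0) homZ ractr0. Qed.
Lemma homN x : f (- x) = - f x.
Proof. by apply/eqP; rewrite -addr_eq0 -homD addNr hom0. Qed.
Lemma homB x y : f (x - y) = f x - f y. Proof. by rewrite homD homN. Qed.
End Homs.

Lemma submodN M (P : M -> Prop) x : submod P -> P x -> P (- x).
Proof.
move=> [_ [_ PZ]] /(PZ _ (-1)); rewrite /ract.
by have -> : ((-1 : A) : A^c) = -1 by []; rewrite scaleN1r.
Qed.

Lemma submodB M (P : M -> Prop) x y : submod P -> P x -> P y -> P (x - y).
Proof. by move=> hP Px Py; apply: (hP.2.1) => //; apply: submodN. Qed.

(** A nonzero submodule contains a nonzero cyclic one, so it suffices to test essentiality on cyclic
    submodules. *)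
Lemma essentialP M (P : M -> Prop) :
  essential P <-> submod P /\ forall x, x <> 0 -> exists a, P (x *> a) /\ x *> a <> 0.
Proof.
split=> -[sP eP]; split=> //; [move=> x nx|move=> N [N0 [ND NZ]] [x [Nx nx]]].
  have [] := eP (fun y => exists a, y = x *> a).
  - split; first by exists 0; rewrite ractr0.
    split=> [y z [a ->] [b ->]|y b [a ->]]; first by exists (a + b); rewrite ractDr.
    by exists (a * b); rewrite ractM.
  - by exists x; split=> //; exists 1; rewrite ract1.
  - by move=> _ [[a ->] [Pa na]]; exists a.
by have [a [Pa na]] := eP x nx; exists (x *> a); split; first exact: NZ.
Qed.

Local Notation ess := (@essential_right_ideal A).

Lemma essP I :
  ess I <-> right_ideal I /\ forall x, x <> 0 -> exists a, I (x * a) /\ x * a <> 0.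
Proof.
split=> -[sP eP]; split=> //; [move=> x nx|move=> N [N0 [ND NZ]] [x [Nx nx]]].
  have [] := eP (fun y => exists a, y = x * a).
  - split; first by exists 0; rewrite mulr0.
    split=> [y z [a ->] [b ->]|y b [a ->]]; first by exists (a + b); rewrite mulrDr.
    by exists (a * b); rewrite mulrA.
  - by exists x; split=> //; exists 1; rewrite mulr1.
  - by move=> _ [[a ->] [Pa na]]; exists a.
by have [a [Pa na]] := eP x nx; exists (x * a); split; first exact: NZ.
Qed.

Lemma ess_sub I J : ess I -> right_ideal J -> (forall a, I a -> J a) -> ess J.
Proof.
move=> /essP[_ eI] rJ IJ; apply/essP; split=> // x /eI[a [Ia na]].
by exists a; split=> //; apply: IJ.
Qed.

Lemma essT : ess (fun=> True).
Proof. by apply/essP; split=> // x nx; exists 1; rewrite mulr1. Qed.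

Lemma essI I J : ess I -> ess J -> ess (fun a => I a /\ J a).
Proof.
move=> /essP[[I0 [ID IM]] eI] /essP[[J0 [JD JM]] eJ]; apply/essP; split.
  split=> //; split=> [x y [? ?] [? ?]|x a [? ?]]; split; auto.
move=> x /eI[a [Ia na]]; have [b [Jb nb]] := eJ _ na.
by exists (a * b); rewrite mulrA; do !split=> //; apply: IM.
Qed.

Lemma ess_preimage M (P : M -> Prop) x : essential P -> ess (fun a => P (x *> a)).
Proof.
move=> /essentialP[[P0 [PD PZ]] eP]; apply/essP; split.
  by split; [rewrite ractr0|split=> [a b|a b]; rewrite ?ractDr ?ractM; auto].
move=> a na; have [xa0|nxa] := pselect (x *> a = 0).
  by exists 1; rewrite mulr1 xa0.
have [b [Pb nb]] := eP _ nxa; exists b; rewrite ractM; split=> // ab0.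
by apply: nb; rewrite -ractM ab0 ractr0.
Qed.

Lemma ess_colon I a : ess I -> ess (fun b => I (a * b)).
Proof.
move=> /essP[[I0 [ID IM]] eI]; apply/essP; split.
  by split; [rewrite mulr0|split=> [b c|b c]; rewrite ?mulrDr ?mulrA; auto].
move=> b nb; have [ab0|nab] := pselect (a * b = 0).
  by exists 1; rewrite mulr1 ab0.
have [c [Ic nc]] := eI _ nab; exists c; rewrite mulrA; split=> // bc0.
by apply: nc; rewrite -mulrA bc0 mulr0.
Qed.

Lemma right_ideal_rann M (x : M) : right_ideal (rann x).
Proof.
rewrite /rann; split; first exact: ractr0.
split=> [a b xa xb|a b xa]; first by rewrite ractDr xa xb addr0.
by rewrite ractM xa ract0.
Qed.

(** The main use of non-singularity: an equation between elements may be checked after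
    multiplication by an essential right ideal. *)
Lemma nonsing_eq0 M (x : M) I :
  nonsingular_module M -> ess I -> (forall a, I a -> x *> a = 0) -> x = 0.
Proof.
move=> nsM eI xI; apply: contrapT => /nsM; apply; apply: ess_sub eI _ xI.
exact: right_ideal_rann.
Qed.

Lemma nonsing_eq M (x y : M) I : nonsingular_module M -> ess I ->
  (forall a, I a -> x *> a = y *> a) -> x = y.
Proof.
move=> nsM eI xyI; apply/eqP; rewrite -subr_eq0; apply/eqP.
by apply: nonsing_eq0 nsM eI _ => a /xyI; rewrite ractB => ->; rewrite subrr.
Qed.

Lemma hom_eq_essential M N (P : M -> Prop) (f g : M -> N) :
  nonsingular_module N -> is_hom f -> is_hom g -> essential P ->
  (forall x, P x -> f x = g x) -> f =1 g.
Proof.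
move=> nsN hf hg eP fg x; apply: nonsing_eq nsN (ess_preimage x eP) _ => a /fg.
by rewrite !homZ.
Qed.

(** If [r(x)] is essential, so is its colon ideal by [a], which lies in [r(x a)]; a nonzero singular
    element thus has a nonzero singular multiple in [P]. *)
Lemma essential_nonsing M (P : M -> Prop) : essential P ->
  (forall x, P x -> x <> 0 -> ~ ess (rann x)) -> nonsingular_module M.
Proof.
move=> /essentialP[_ eP] nsP x /eP[a [Pa na]] ex.
apply: (nsP _ Pa na); apply: ess_sub (ess_colon a ex) (right_ideal_rann _) _.
by move=> b; rewrite /rann ractM.
Qed.

(** Zorn's lemma gives a [Q] maximal with zero intersection with [P]. If some nonzero [x] had no
    nonzero multiple in [P + Q], then [Q + x A] would still meet [P] in zero. *)
Lemma exists_complement M (P : M -> Prop) : submod P ->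
  exists Q, [/\ submod Q, forall x, P x -> Q x -> x = 0 &
    essential (fun x => exists p q, [/\ P p, Q q & x = p + q])].
Proof.
move=> sP; have [P0 [PD PZ]] := sP.
pose ok (Q : set M) := submod Q /\ forall x, P x -> Q x -> x = 0.
pose R (Q1 Q2 : {Q | ok Q}) := `[< forall x, sval Q1 x -> sval Q2 x >].
have ok0 : ok (fun x => x = 0).
  split=> [|//]; split=> //; split=> [x y -> ->|x a ->]; first by rewrite addr0.
  by rewrite ract0.
have [||F totF|[Q [sQ PQ]] maxQ] := @ZL_preorder _ (exist _ _ ok0) R.
- by move=> Q; apply/asboolP.
- by move=> Q1 Q2 Q3 /asboolP Q12 /asboolP Q23; apply/asboolP => x /Q12/Q23.
(* The disjunct [x = 0] takes care of the empty chain. *)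
- pose U x := x = 0 \/ exists2 Q, F Q & sval Q x.
  have okU : ok U.
    split; last by move=> x Px [//|[[Q [sQ PQ]] _ /= Qx]]; apply: PQ.
    split; first by left.
    split=> [x y|x a].
      move=> [->|[Q1 F1 Q1x]]; first by rewrite add0r.
      move=> [->|[Q2 F2 Q2y]]; first by rewrite addr0; right; exists Q1.
      right; have [/asboolP Q12|/asboolP Q21] := totF _ _ F1 F2.
        by exists Q2 => //; have [_ [D _]] := (svalP Q2).1; apply: D => //; apply: Q12.
      by exists Q1 => //; have [_ [D _]] := (svalP Q1).1; apply: D => //; apply: Q21.
    move=> [->|[Q FQ Qx]]; first by left; rewrite ract0.
    by right; exists Q => //; have [_ [_ Z]] := (svalP Q).1; apply: Z.
  exists (exist _ _ okU) => Q FQ; apply/asboolP => x Qx /=.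
  by right; exists Q.
have [Q0 [QD QZ]] := sQ.
have maxQ' (Q' : M -> Prop) :
    ok Q' -> (forall x, Q x -> Q' x) -> forall x, Q' x -> Q x.
  by move=> okQ' /asboolP /(maxQ (exist _ _ okQ')) /asboolP.
exists Q; split=> //; apply/essentialP; split.
  split; first by exists 0, 0; rewrite addr0.
  split=> [x y [p [q [Pp Qq ->]]] [p' [q' [Pp' Qq' ->]]]|x a [p [q [Pp Qq ->]]]].
    by exists (p + p'), (q + q'); split; [exact: PD|exact: QD|rewrite addrACA].
  by exists (p *> a), (q *> a); split; [exact: PZ|exact: QZ|rewrite ractD].
move=> x nx; apply: contrapT => noa.
have xa0 a p q : P p -> Q q -> x *> a = p + q -> x *> a = 0.
  by move=> Pp Qq e; apply: contrapT => na; apply: noa; exists a; split=> //; exists p, q.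
apply: nx; rewrite -(ract1 x); apply: (xa0 _ 0 x) => //; last first.
  by rewrite add0r ract1.
apply: (maxQ' (fun y => exists q a, Q q /\ y = q + x *> a)).
- split.
    split; first by exists 0, 0; rewrite ractr0 addr0.
    split=> [y z [q [a [Qq ->]]] [q' [a' [Qq' ->]]]|y b [q [a [Qq ->]]]].
      by exists (q + q'), (a + a'); split; [exact: QD|rewrite ractDr addrACA].
    by exists (q *> b), (a * b); split; [exact: QZ|rewrite ractD ractM].
  move=> y Py [q [a [Qq e]]].
  have e' : x *> a = y + - q by rewrite e addrC addKr.
  have xa := xa0 _ _ _ Py (submodN sQ Qq) e'.
  by apply: (PQ) => //; rewrite e xa addr0.
- by move=> q Qq; exists q, 0; rewrite ractr0 addr0.
- by exists 0, 1; rewrite ract1 add0r.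
Qed.

(** Baer's criterion restricted to essential right ideals. The function [g] is total but constrained
    only on [I], which avoids a subtype. *)
Definition complete E := forall I (g : A -> E), ess I ->
  (forall a b, I a -> I b -> g (a + b) = g a + g b) ->
  (forall a b, I a -> g (a * b) = g a *> b) ->
  exists x, forall a, I a -> g a = x *> a.

(** Let [G] send [p + q] to [g p]. For each [x] the elements [a] with [x a] in [P + Q] form an
    essential right ideal, so completeness yields [h x] with [G (x a) = h x a]; non-singularity
    makes [h] a homomorphism. *)
Lemma extend_hom_by0 N E (P Q : N -> Prop) (g : N -> E) :
  nonsingular_module E -> complete E -> submod P -> submod Q ->
  (forall x, P x -> Q x -> x = 0) ->
  essential (fun x => exists p q, [/\ P p, Q q & x = p + q]) ->
  (forall x y, P x -> P y -> g (x + y) = g x + g y) ->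
  (forall x a, P x -> g (x *> a) = g x *> a) ->
  exists h : N -> E, is_hom h /\ forall p q, P p -> Q q -> h (p + q) = g p.
Proof.
move=> nsE cE sP sQ PQ eQ gD gZ.
have [P0 [PD PZ]] := sP; have [Q0 [QD QZ]] := sQ.
pose S x := exists p q, [/\ P p, Q q & x = p + q].
have uniq p q p' q' : P p -> Q q -> P p' -> Q q' -> p + q = p' + q' -> p = p'.
  move=> Pp Qq Pp' Qq' e; apply/eqP; rewrite -subr_eq0; apply/eqP.
  have e' : p - p' = q' - q.
    by apply/eqP; rewrite subr_eq addrAC -(addrC p') -e addrK.
  by apply: PQ; [exact: submodB|rewrite e'; exact: submodB].
have [G hG] : exists G : N -> E, forall p q, P p -> Q q -> G (p + q) = g p.
  have /choice[G hG] : forall x, exists y, forall p q, P p -> Q q -> x = p + q -> y = g p.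
    move=> x; have [[p [q [Pp Qq ->]]]|nS] := pselect (S x).
      by exists (g p) => p' q' Pp' Qq' /uniq ->.
    by exists 0 => p q Pp Qq e; case: nS; exists p, q.
  by exists G => p q Pp Qq; apply: (hG _ p q).
have GD x y : S x -> S y -> G (x + y) = G x + G y.
  move=> [p [q [Pp Qq ->]]] [p' [q' [Pp' Qq' ->]]].
  by rewrite addrACA !hG ?gD //; [exact: PD|exact: QD].
have GZ x a : S x -> G (x *> a) = G x *> a.
  by move=> [p [q [Pp Qq ->]]]; rewrite ractD !hG ?gZ //; [exact: PZ|exact: QZ].
have /choice[h hh] : forall x, exists y, forall a, S (x *> a) -> G (x *> a) = y *> a.
  move=> x; apply: (cE _ _ (ess_preimage x eQ)) => [a b Sa Sb|a b Sa].
    by rewrite ractDr GD.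
  by rewrite ractM GZ.
exists h; split; [split|] => [x y|x a|p q Pp Qq].
- apply: nonsing_eq nsE (essI (ess_preimage x eQ) (ess_preimage y eQ)) _ => a [Sx Sy].
  rewrite ractD -!hh ?ractD ?GD //; exact: (eQ.1.2.1).
- apply: nonsing_eq nsE (ess_preimage (x *> a) eQ) _ => b Sb.
  by rewrite -hh // -!ractM -hh ?ractM // -ractM.
- apply: nonsing_eq nsE essT _ => a _; rewrite -hh ractD.
    by rewrite hG ?gZ //; [exact: PZ|exact: QZ].
  by exists (p *> a), (q *> a); split=> //; [exact: PZ|exact: QZ].
Qed.

Lemma extend_hom N E (P : N -> Prop) (g : N -> E) :
  nonsingular_module E -> complete E -> submod P ->
  (forall x y, P x -> P y -> g (x + y) = g x + g y) ->
  (forall x a, P x -> g (x *> a) = g x *> a) ->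
  exists h : N -> E, is_hom h /\ forall x, P x -> h x = g x.
Proof.
move=> nsE cE sP gD gZ; have [Q [sQ PQ eQ]] := exists_complement sP.
have [h [hh hg]] := extend_hom_by0 nsE cE sP sQ PQ eQ gD gZ.
by exists h; split=> // x Px; rewrite -(hg x 0) ?addr0 //; case: sQ.
Qed.

Lemma complete_injective E :
  nonsingular_module E -> complete E -> injective_module E.
Proof.
move=> nsE cE M N f g hf injf hg.
have [g' hg'] : exists g' : N -> E, forall x, g' (f x) = g x.
  have /choice[g' hg'] : forall y, exists z, forall x, y = f x -> z = g x.
    move=> y; have [[x ->]|nf] := pselect (exists x, y = f x).
      by exists (g x) => x' /injf ->.
    by exists 0 => x e; case: nf; exists x.
  by exists g' => x; apply: hg'.
have [] := @extend_hom N E (fun y => exists x, y = f x) g' nsE cE.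
- split; first by exists 0; rewrite hom0.
  split=> [_ _ [x ->] [y ->]|_ a [x ->]]; first by exists (x + y); rewrite homD.
  by exists (x *> a); rewrite homZ.
- by move=> _ _ [x ->] [y ->]; rewrite -homD // !hg' homD.
- by move=> _ a [x ->]; rewrite -homZ // !hg' homZ.
move=> h [hh hf']; exists h; split=> // x; rewrite hf' ?hg' //; by exists x.
Qed.
End Modules.

(** * The injective hull of a non-singular module *)

Section Hull.
Variables (A : pzRingType) (M : lmodType A^c).
Local Notation ess := (@essential_right_ideal A).

(** The filter generated by the essential right ideals; germs below are taken along it. *)
Definition near_ess (P : A -> Prop) := exists I, ess I /\ forall a, I a -> P a.

Lemma near_and P Q R : near_ess P -> near_ess Q ->
  (forall a, P a -> Q a -> R a) -> near_ess R.
Proof.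
move=> [I [eI IP]] [J [eJ JQ]] PQR; exists (fun a => I a /\ J a).
by split=> [|a [/IP Pa /JQ]]; [exact: essI|exact: PQR].
Qed.

Lemma near_conj P Q : near_ess P -> near_ess Q -> near_ess (fun a => P a /\ Q a).
Proof. by move=> nP nQ; apply: near_and nP nQ _. Qed.

Lemma near_colon P a : near_ess P -> near_ess (fun b => P (a * b)).
Proof.
by move=> [I [eI IP]]; exists (fun b => I (a * b)); split; [exact: ess_colon|auto].
Qed.

Lemma near_all (P : A -> Prop) : (forall a, P a) -> near_ess P.
Proof. by move=> allP; exists (fun=> True); split=> //; exact: essT. Qed.

(** Homomorphisms into [M] from essential right ideals. Modulo agreement on a smaller essential
    right ideal they form the direct limit of the [Hom(I, M)], which is the hull when [A] and [M]
    are non-singular. *)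
Record phom := PHom {
  pdom : A -> Prop;
  pfun : A -> M;
  ess_pdom : ess pdom;
  pfunD : forall a b, pdom a -> pdom b -> pfun (a + b) = pfun a + pfun b;
  pfunZ : forall a b, pdom a -> pfun (a * b) = pfun a *> b }.

HB.instance Definition _ := gen_eqMixin phom.
HB.instance Definition _ := gen_choiceMixin phom.

Lemma near_pdom x : near_ess (pdom x).
Proof. by exists (pdom x); split=> //; exact: ess_pdom. Qed.

Lemma phom_const (m : M) : exists x : phom,
  forall a, pfun x a = m *> a.
Proof.
have D a b : True -> True -> m *> (a + b) = m *> a + m *> b by rewrite ractDr.
have Z a b : True -> m *> (a * b) = m *> a *> b by rewrite ractM.
by exists (PHom (essT A) D Z).
Qed.

Lemma phom_add (x y : phom) : exists z : phom,
  forall a, pfun z a = pfun x a + pfun y a.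
Proof.
pose f a := pfun x a + pfun y a.
have D a b : pdom x a /\ pdom y a -> pdom x b /\ pdom y b -> f (a + b) = f a + f b.
  by move=> [? ?] [? ?]; rewrite /f !pfunD // addrACA.
have Z a b : pdom x a /\ pdom y a -> f (a * b) = f a *> b.
  by move=> [? ?]; rewrite /f !pfunZ // ractD.
by exists (PHom (essI (ess_pdom x) (ess_pdom y)) D Z).
Qed.

Lemma phom_scale (x : phom) c : exists z : phom,
  forall a, pfun z a = pfun x (c * a).
Proof.
pose f a := pfun x (c * a).
have D a b : pdom x (c * a) -> pdom x (c * b) -> f (a + b) = f a + f b.
  by move=> ? ?; rewrite /f mulrDr pfunD.
have Z a b : pdom x (c * a) -> f (a * b) = f a *> b.
  by move=> ?; rewrite /f mulrA pfunZ.
by exists (PHom (ess_colon c (ess_pdom x)) D Z).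
Qed.

Definition germ_eq (x y : phom) := `[< near_ess (fun a => pfun x a = pfun y a) >].

Lemma germ_eq_refl : reflexive germ_eq.
Proof. by move=> x; apply/asboolP; apply: near_all. Qed.

Lemma germ_eq_sym : symmetric germ_eq.
Proof.
by move=> x y; apply/asboolP/asboolP => nxy; apply: (near_and nxy nxy) => a ->.
Qed.

Lemma germ_eq_trans : transitive germ_eq.
Proof.
move=> y x z /asboolP xy /asboolP yz; apply/asboolP.
by apply: near_and xy yz _ => a ->.
Qed.

Canonical germ_equiv := EquivRel germ_eq germ_eq_refl germ_eq_sym germ_eq_trans.

Definition germ : Type := {eq_quot germ_equiv}%qT.
HB.instance Definition _ := Choice.on germ.
HB.instance Definition _ := EqQuotient.on germ.

Definition germ_of (x : phom) : germ := (\pi_germ x)%qT.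
Definition gval (X : germ) : A -> M := pfun (repr X).

Lemma gval_germ_of x : near_ess (fun a => gval (germ_of x) a = pfun x a).
Proof.
have /eqmodP/asboolP// : (repr (germ_of x) = x %[mod {eq_quot germ_equiv}])%qT.
by rewrite /germ_of reprK.
Qed.

Lemma germP (X Y : germ) : near_ess (fun a => gval X a = gval Y a) -> X = Y.
Proof.
move=> XY; rewrite -(reprK X) -(reprK Y).
by apply/eqmodP/asboolP.
Qed.

Definition germ_const m := germ_of (projT1 (cid (phom_const m))).
Definition germ_add (X Y : germ) := germ_of (projT1 (cid (phom_add (repr X) (repr Y)))).
Definition germ_scale c (X : germ) := germ_of (projT1 (cid (phom_scale (repr X) c))).

Lemma gval_const m : near_ess (fun a => gval (germ_const m) a = m *> a).
Proof.
rewrite /germ_const; case: cid => x /= xE.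
by apply: near_and (gval_germ_of x) (near_all xE) _ => a -> ->.
Qed.

Lemma gvalD X Y : near_ess (fun a => gval (germ_add X Y) a = gval X a + gval Y a).
Proof.
rewrite /germ_add; case: cid => x /= xE.
by apply: near_and (gval_germ_of x) (near_all xE) _ => a -> ->.
Qed.

Lemma gvalZ c X : near_ess (fun a => gval (germ_scale c X) a = gval X (c * a)).
Proof.
rewrite /germ_scale; case: cid => x /= xE.
by apply: near_and (gval_germ_of x) (near_all xE) _ => a -> ->.
Qed.

Lemma germ_addA : associative germ_add.
Proof.
move=> X Y Z; apply: germP.
apply: near_and (near_conj (gvalD X Y) (gvalD (germ_add X Y) Z))
  (near_conj (gvalD Y Z) (gvalD X (germ_add Y Z))) _.
by move=> a /= [e1 ->] [e2 ->]; rewrite e1 e2 addrA.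
Qed.

Lemma germ_addC : commutative germ_add.
Proof.
move=> X Y; apply: germP; apply: near_and (gvalD X Y) (gvalD Y X) _ => a -> ->.
exact: addrC.
Qed.

Lemma germ_add0 : left_id (germ_const 0) germ_add.
Proof.
move=> X; apply: germP; apply: near_and (gvalD (germ_const 0) X) (gval_const 0) _ => a -> ->.
by rewrite ract0 add0r.
Qed.

Lemma germ_addN : left_inverse (germ_const 0) (germ_scale (-1)) germ_add.
Proof.
move=> X; apply: germP.
apply: near_and (near_conj (gvalD (germ_scale (-1) X) X) (gvalZ (-1) X))
  (near_conj (near_pdom (repr X)) (gval_const 0)) _.
move=> a /= [-> ->] [Xa ->]; rewrite ract0 mulN1r -mulrN1 /gval pfunZ //.
by rewrite -{2}(ract1 (pfun _ a)) -ractDr addNr ractr0.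
Qed.

HB.instance Definition _ :=
  GRing.isZmodule.Build germ germ_addA germ_addC germ_add0 germ_addN.

(** The product [a * b] of [A^c] is [b * a] in [A], and both sides take at [c] the value of [X] at
    [b * a * c]. *)
Lemma germ_scaleA (a b : A^c) X :
  germ_scale a (germ_scale b X) = germ_scale (a * b) X.
Proof.
apply: germP.
apply: near_and (near_conj (gvalZ a (germ_scale b X)) (near_colon a (gvalZ b X)))
  (gvalZ ((b : A) * a) X) _ => c [-> ->] ->.
by rewrite mulrA.
Qed.

Lemma germ_scale1 : left_id 1 (germ_scale : A^c -> germ -> germ).
Proof.
move=> X; apply: germP; apply: near_and (gvalZ 1 X) (near_pdom (repr X)) _ => a.
by rewrite mul1r.
Qed.

Lemma germ_scaleDr : right_distributive (germ_scale : A^c -> germ -> germ) +%R.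
Proof.
move=> c X Y; apply: germP.
apply: near_and (near_conj (gvalZ c (X + Y)) (near_colon c (gvalD X Y)))
  (near_conj (near_conj (gvalZ c X) (gvalZ c Y))
    (gvalD (germ_scale c X) (germ_scale c Y))) _.
by move=> a /= [-> ->] [[e1 e2] ->]; rewrite e1 e2.
Qed.

Lemma germ_scaleDl X :
  {morph (germ_scale^~ X : A^c -> germ) : a b / a + b >-> a + b}.
Proof.
move=> a b; apply: germP.
apply: near_and (near_conj (near_conj (gvalZ (a + b) X) (near_colon a (near_pdom (repr X))))
    (near_colon b (near_pdom (repr X))))
  (near_conj (near_conj (gvalZ a X) (gvalZ b X))
    (gvalD (germ_scale a X) (germ_scale b X))) _.
move=> c /= [[-> Xa] Xb] [[e1 e2] ->].
by rewrite e1 e2 mulrDl /gval pfunD.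
Qed.

HB.instance Definition _ := GRing.Zmodule_isLmodule.Build A^c germ
  germ_scaleA germ_scale1 germ_scaleDr germ_scaleDl.

Lemma germ_const_hom : is_hom germ_const.
Proof.
split=> [x y|x a]; apply: germP.
  apply: near_and (near_conj (gval_const x) (gval_const y))
    (near_conj (gval_const (x + y)) (gvalD (germ_const x) (germ_const y))) _.
  by move=> a /= [e1 e2] [-> ->]; rewrite e1 e2 ractD.
apply: near_and (near_conj (gval_const (x *> a)) (near_colon a (gval_const x)))
  (gvalZ a (germ_const x)) _.
by move=> b /= [-> e] ->; rewrite e ractM.
Qed.

(** Multiplying a germ by an element of its domain lands in [M]; essentiality and completeness of
    the germ module both rest on this. *)
Lemma germ_of_ract x a : pdom x a -> germ_of x *> a = germ_const (pfun x a).
Proof.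
move=> xa; apply: germP.
apply: near_and (near_conj (gvalZ a (germ_of x)) (near_colon a (gval_germ_of x)))
  (gval_const (pfun x a)) _ => b [-> ->] ->.
by rewrite pfunZ.
Qed.

Hypotheses (nsA : right_nonsingular A) (nsM : nonsingular_module M).

Lemma germ_const_inj : injective germ_const.
Proof.
move=> x y xy.
have := gval_const x; rewrite xy => /near_and/(_ (gval_const y)).
move=> /(_ (fun a => x *> a = y *> a))[a -> //|I [eI]].
exact: nonsing_eq.
Qed.

Lemma germ_const_essential : essential (fun X => exists x, X = germ_const x).
Proof.
have hc := germ_const_hom.
apply/essentialP; split.
  split; first by exists 0; rewrite (hom0 hc).
  split=> [_ _ [x ->] [y ->]|_ a [x ->]]; first by exists (x + y); rewrite (homD hc).
  by exists (x *> a); rewrite (homZ hc).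
move=> X nX; apply: contrapT => noa; apply: nX; apply: germP.
apply: near_and (near_pdom (repr X)) (gval_const 0) _ => a Xa ->.
rewrite ract0; apply: contrapT => na; apply: noa; exists a.
have := germ_of_ract Xa; rewrite [germ_of _]reprK => ->.
by split; [exists (pfun (repr X) a)|rewrite -(hom0 hc) => /germ_const_inj].
Qed.

Lemma germ_nonsing : nonsingular_module germ.
Proof.
apply: essential_nonsing germ_const_essential _ => _ [x ->] nx.
have {}nx : x <> 0 by move=> x0; apply: nx; rewrite x0 (hom0 germ_const_hom).
move=> ex; apply: (nsM nx); apply: ess_sub ex (right_ideal_rann _) _ => a.
rewrite /rann -(homZ germ_const_hom) -(hom0 germ_const_hom).
exact: germ_const_inj.
Qed.

Lemma germ_complete : complete germ.
Proof.
move=> J g eJ gD gZ; have [[J0 [JD JM]] _] := eJ.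
have eC := germ_const_essential.
(* On this smaller ideal [g] takes values in the image of [M], hence is itself a partial
   homomorphism; its germ is the required element. *)
pose I a := J a /\ exists x, g a = germ_const x.
have eI : ess I.
  apply/essP; split.
    split; first by split=> //; exists 0; rewrite -{1}(mulr0 0) gZ // ractr0 (hom0 germ_const_hom).
    split=> [a b [Ja [x gx]] [Jb [y gy]]|a b [Ja [x gx]]].
      by split; [exact: JD|exists (x + y); rewrite gD // (homD germ_const_hom) gx gy].
    by split; [exact: JM|exists (x *> b); rewrite gZ // (homZ germ_const_hom) gx].
  (* Right non-singularity of [A] enters here: the essential ideal of all [b] with [g (x * a) *> b]
     in the image of [M] cannot be contained in [r(x * a)]. *)
  move=> x /((essP J).1 eJ).2[a [Ja na]].
  have eL := ess_preimage (g (x * a)) eC.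
  have [b [Lb nb]] : exists b, (exists y, g (x * a) *> b = germ_const y) /\ x * a * b <> 0.
    apply: contrapT => nob; apply: (nsA na); apply: ess_sub eL _ _.
      split; first exact: mulr0.
      split=> [b c xb xc|b c xb]; first by rewrite mulrDr xb xc addr0.
      by rewrite mulrA xb mul0r.
    by move=> b Lb; apply: contrapT => nb; apply: nob; exists b.
  exists (a * b); rewrite mulrA; split=> //.
  by split; [exact: JM|rewrite gZ].
have /choice[f fI] : forall a, exists x, I a -> g a = germ_const x.
  move=> a; have [[_ [x gx]]|nI] := pselect (I a); first by exists x.
  by exists 0.
have [[_ [ID IM]] _] := eI.
have fD a b : I a -> I b -> f (a + b) = f a + f b.
  move=> Ia Ib; apply: germ_const_inj; rewrite (homD germ_const_hom) -!fI //; last exact: ID.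
  by apply: gD; [case: Ia|case: Ib].
have fZ a b : I a -> f (a * b) = f a *> b.
  move=> Ia; apply: germ_const_inj; rewrite (homZ germ_const_hom) -!fI //; last exact: IM.
  by apply: gZ; case: Ia.
exists (germ_of (PHom eI fD fZ)) => a Ja.
apply: nonsing_eq germ_nonsing (ess_colon a eI) _ => b Iab.
by rewrite -gZ // -ractM germ_of_ract //= fI.
Qed.

Lemma exists_hull : exists (E : lmodType A^c) (i : M -> E),
  [/\ is_hom i, injective i, essential (fun y => exists x, y = i x),
      nonsingular_module E & complete E].
Proof.
exists germ, germ_const; split.
- exact: germ_const_hom.
- exact: germ_const_inj.
- exact: germ_const_essential.
- exact: germ_nonsing.
- exact: germ_complete.
Qed.
End Hull.

(** * Submodules as modules in their own right *)

Section Submodule.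
Variables (A : pzRingType) (E : lmodType A^c) (P : E -> Prop).

Definition submod_pred (y : E) := `[< P y >].
(** The proof of [submod P] is a phantom argument, so that the module structure can be attached to
    the type. *)
Definition submod_type of submod P := {y : E | submod_pred y}.

Hypothesis sP : submod P.
HB.instance Definition _ := SubChoice.on (submod_type sP).

Lemma submod_pred_closed : subsemimod_closed submod_pred.
Proof.
have [P0 [PD PZ]] := sP; split; last by move=> a x /asboolP Px; apply/asboolP/PZ.
by split; [apply/asboolP|move=> x y /asboolP Px /asboolP Py; apply/asboolP/PD].
Qed.

HB.instance Definition _ := GRing.SubChoice_isSubLmodule.Build A^c E submod_pred
  (submod_type sP) submod_pred_closed.

Lemma exists_submod_type : exists (M : lmodType A^c) (i : M -> E),
  [/\ is_hom i, injective i & forall y, P y <-> exists x, y = i x].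
Proof.
exists (submod_type sP : lmodType A^c), val; split.
- by split=> [x y|x a]; [exact: raddfD|exact: linearZ].
- exact: val_inj.
move=> y; split=> [Py|[x ->]]; last by have /asboolP := valP x.
by exists (Sub y (asboolT Py)); rewrite SubK.
Qed.
End Submodule.

(** * From injectivity to strong semiprimeness *)

Section InjectiveToSemiprime.
Variable A : pzRingType.

Lemma hom_rann (M N : lmodType A^c) (f : M -> N) x a :
  is_hom f -> x *> a = 0 -> f x *> a = 0.
Proof. by move=> hf xa; rewrite -(homZ hf) xa (hom0 hf). Qed.

Lemma strongly_semiprime_of_injective : right_nonsingular A ->
  (forall M : lmodType A^c,
     nonsingular_module M -> automorphism_invariant M -> injective_module M) ->
  right_strongly_semiprime A.
Proof.
move=> nsA injA I [[I0 [ID IM]] IL] eI.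
(* The regular module of [A^c] is [A] as a right module over itself. *)
have nsR : nonsingular_module ((A^c)^o : lmodType A^c) by exact: nsA.
have [E [i [hi inji ei nsE cE]]] := exists_hull nsA nsR.
have injE := complete_injective nsE cE.
pose ann (s : seq A) (a : A) := forall x, x \in s -> x * a = 0.
pose P (y : E) := exists2 s : seq A,
  (forall x, x \in s -> I x) & (forall a, ann s a -> y *> a = 0).
have sP : submod P.
  split; first by exists [::] => // a _; rewrite ract0.
  split=> [y z [s sI sy] [t tI tz]|y b [s sI sy]].
    exists (s ++ t) => [x|a sta]; first by rewrite mem_cat => /orP[/sI|/tI].
    rewrite ractD sy ?tz ?addr0 // => x xs; apply: sta; rewrite mem_cat xs ?orbT //.
  exists [seq x * b | x <- s] => [_ /mapP[x /sI Ix ->]|a sa]; first exact: IM.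
  rewrite -ractM sy // => x xs; rewrite mulrA; apply: sa; exact: map_f.
have iP a : I a -> P (i (a : A^c)).
  move=> Ia; exists [:: a] => [x|b ab]; first by rewrite inE => /eqP ->.
  by apply: (@hom_rann (A^c)^o E i a b hi); apply: ab; exact: mem_head.
have eP : essential P.
  apply/essentialP; split=> // y /((essentialP _).1 ei).2[a [[x ya] na]].
  have nx : (x : A) <> 0 by move=> x0; apply: na; rewrite ya x0 (hom0 hi).
  have [b [Ib nb]] := ((essP I).1 eI).2 x nx.
  exists (a * b); rewrite ractM ya -(homZ hi); split; first exact: iP.
  by rewrite -(hom0 hi) => /inji.
have [M [j [hj injj jP]]] := exists_submod_type sP.
have nsM : nonsingular_module M.
  move=> x nx ex; apply: (nsE (j x)); first by rewrite -(hom0 hj) => /injj.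
  apply: ess_sub ex (right_ideal_rann _) _ => a; exact: hom_rann.
have eM (y : E) : y <> 0 -> exists a x, y *> a = j x /\ x <> 0.
  move=> /((essentialP _).1 eP).2[a [/jP[x ya] na]]; exists a, x; split=> // x0.
  by apply: na; rewrite ya x0 (hom0 hj).
(* Any hull [E'] of [M] embeds in [E] over [M]. Homomorphisms can only enlarge annihilators, so the
   condition defining [P] survives every endomorphism of [E'], and [M] is automorphism-invariant. *)
have injM : injective_module M.
  apply: injA => // E' i' [hi' [inji' [_ ei']]] f hf _ x.
  have [h [hh hi'j]] := injE M E' i' j hi' inji' hj.
  have injh : injective h.
    move=> y z hyz; apply/eqP; rewrite -subr_eq0; apply/eqP; apply: contrapT.
    move=> /((essentialP _).1 ei').2[a [[w ya] na]]; apply: na.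
    have : h ((y - z) *> a) = 0 by rewrite (homZ hh) (homB hh) hyz subrr ract0.
    by rewrite ya hi'j -(hom0 hj) => /injj ->; rewrite (hom0 hi').
  have [s sI sx] : P (j x) by apply/jP; exists x.
  have [|z hz] := (jP (h (f (i' x)))).1.
    exists s => // a /sx jxa.
    have xa : x *> a = 0 by apply: injj; rewrite (homZ hj) jxa (hom0 hj).
    apply: (hom_rann (f := h)) => //; apply: (hom_rann (f := f)) => //.
    by rewrite -(homZ hi') xa (hom0 hi').
  by exists z; apply: injh; rewrite hz hi'j.
(* Injectivity of [M] gives a retraction [h] of [E] onto [M]; as [M] is essential in [E], the kernel
   of [h] is zero. *)
have [h [hh hj1]] := injM M E j id hj injj (conj (fun _ _ => erefl) (fun _ _ => erefl)).
have [s sI s1] : P (i 1).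
  apply/jP; exists (h (i 1)); apply/eqP; rewrite -subr_eq0; apply/eqP.
  (* Since [h y = 0], a multiple [y *> a = j x] gives [x = h (j x) = h y *> a = 0]. *)
  set y := _ - _; apply: contrapT => /eM[a [x [ya]]]; apply.
  by rewrite -(hj1 x) -ya (homZ hh) /y (homB hh) hj1 subrr ract0.
exists s; split=> // a /s1; rewrite -(homZ hi) -(hom0 hi) => /inji.
by rewrite /ract /GRing.scale /= => <-; rewrite [RHS]mul1r.
Qed.
End InjectiveToSemiprime.

(** * Strongly semiprime rings *)

Section StronglySemiprime.
Variable A : pzRingType.
Local Notation ess := (@essential_right_ideal A).
Hypothesis sspA : right_strongly_semiprime A.

(* The left annihilator of [A a A] is essential when [a A a = 0], while all of its
   elements kill [a]. *)
Lemma strongly_semiprime_semiprime (a : A) : (forall b, a * b * a = 0) -> a = 0.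
Proof.
move=> aAa; pose I c := forall b, c * b * a = 0.
have [||s [sI s0]] := @sspA I.
- split; last by move=> c d Id b; rewrite -!mulrA (mulrA d) Id mulr0.
  split; first by move=> b; rewrite !mul0r.
  by split=> [c d Ic Id b|c d Ic b]; rewrite ?mulrDl ?Ic ?Id ?addr0 // -(mulrA c).
- apply/essP; split.
    split; first by move=> b; rewrite !mul0r.
    by split=> [c d Ic Id b|c d Ic b]; rewrite ?mulrDl ?Ic ?Id ?addr0 // -(mulrA c).
  move=> x nx; have [Ix|/existsNP[b nb]] := pselect (I x).
    by exists 1; rewrite mulr1.
  exists (b * a); rewrite mulrA; split=> // c.
  by rewrite -!mulrA [a * _]mulrA aAa !mulr0.
by apply: s0 => x /sI/(_ 1); rewrite mulr1.
Qed.

(** If [x K = 0], then [(k x) b (k x) = k (x (b k)) x = 0] for all [b], so [k x = 0] by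
    semiprimeness; the converse is symmetric. *)
Lemma strongly_semiprime_annC (K : A -> Prop) x : two_sided_ideal K ->
  (forall k, K k -> x * k = 0) <-> (forall k, K k -> k * x = 0).
Proof.
move=> [[_ [_ KR]] KL]; split=> xK k Kk; apply: strongly_semiprime_semiprime => b.
  by rewrite -!mulrA [b * _]mulrA [x * _]mulrA xK ?mul0r ?mulr0 //; exact: KL.
by rewrite -!mulrA [b * _]mulrA [k * _]mulrA [k * _]mulrA xK ?mul0r ?mulr0 //; exact: KR.
Qed.

Definition annihilator_sum (K : A -> Prop) x :=
  exists k b, [/\ K k, forall k', K k' -> k' * b = 0 & x = k + b].

Lemma two_sided_annihilator_sum K :
  two_sided_ideal K -> two_sided_ideal (annihilator_sum K).
Proof.
move=> [[K0 [KD KR]] KL]; split; last first.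
  move=> a _ [k [b [Kk Kb ->]]]; exists (a * k), (a * b); rewrite mulrDr; split=> //.
    exact: KL.
  by move=> k' Kk'; rewrite mulrA Kb //; exact: KR.
split; first by exists 0, 0; split; rewrite ?addr0 // => k _; rewrite mulr0.
split=> [_ _ [k [b [Kk Kb ->]]] [k' [b' [Kk' Kb' ->]]]|_ a [k [b [Kk Kb ->]]]].
  exists (k + k'), (b + b'); rewrite addrACA; split=> //; first exact: KD.
  by move=> c Kc; rewrite mulrDr Kb // Kb' // addr0.
exists (k * a), (b * a); rewrite mulrDl; split=> //; first exact: KR.
by move=> c Kc; rewrite mulrA Kb // mul0r.
Qed.

(** Either [x k] is a nonzero element of [K] for some [k], or [x] kills [K] and then lies in the
    right annihilator of [K] by [strongly_semiprime_annC]. *)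
Lemma ess_annihilator_sum K : two_sided_ideal K -> ess (annihilator_sum K).
Proof.
move=> hK; apply/essP; split; first by have [] := two_sided_annihilator_sum hK.
have [[K0 [KD KR]] KL] := hK.
move=> x nx; have [xK|/existsNP[k /not_implyP[Kk xk]]] := pselect (forall k, K k -> x * k = 0).
  exists 1; rewrite mulr1; split=> //; exists 0, x; rewrite add0r; split=> //.
  exact/strongly_semiprime_annC.
exists k; split=> //; exists (x * k), 0; rewrite addr0; split=> //; first exact: KL.
by move=> k' _; rewrite mulr0.
Qed.

(** Let [Z] be the singular ideal, and take a finite [s] in [Z + r(Z)] with [r(s) = 0]. The
    annihilators of the [Z]-components of [s] meet in an essential [L], and [s] kills the
    intersection of [L] and [Z]. That intersection is therefore zero, and so is [Z]. *)
Lemma strongly_semiprime_nonsingular : right_nonsingular A.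
Proof.
pose Z a := ess (fun b => a * b = 0).
have rA a : right_ideal (fun b => a * b = 0).
  split; first exact: mulr0.
  by split=> [b c ab ac|b c ab]; rewrite ?mulrDr ?mulrA ab ?ac ?addr0 ?mul0r.
have hZ : two_sided_ideal Z.
  split; last first.
    move=> a z Zz; apply: (ess_sub (J := fun b => a * z * b = 0) Zz) => // b zb.
    by rewrite -mulrA zb mulr0.
  split; first by apply: (ess_sub (J := fun b => 0 * b = 0) (essT A)) => // b _; rewrite mul0r.
  split=> [y z Zy Zz|z a Zz].
    apply: (ess_sub (J := fun b => (y + z) * b = 0) (essI Zy Zz)) => // b [yb zb].
    by rewrite mulrDl yb zb addr0.
  by apply: (ess_sub (J := fun b => z * a * b = 0) (ess_colon a Zz)) => // b; rewrite mulrA.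
have [[_ [_ ZR]] ZL] := hZ.
have [s [sZ s0]] :=
  sspA (two_sided_annihilator_sum hZ) (ess_annihilator_sum hZ).
have [L [eL sL]] : exists L, ess L /\ forall w, L w -> Z w -> forall x, x \in s -> x * w = 0.
  elim: s sZ {s0} => [_|x s IHs sZ]; first by exists (fun=> True); split=> //; exact: essT.
  have [|L [eL sL]] := IHs; first by move=> y ys; apply: sZ; rewrite inE ys orbT.
  have [y [b [Zy Zb xE]]] := sZ x (mem_head _ _).
  exists (fun w => L w /\ y * w = 0); split; first exact: essI.
  move=> w [Lw yw] Zw t; rewrite inE => /orP[/eqP ->|]; last exact: sL.
  by rewrite xE mulrDl yw add0r; move: w Zw {Lw yw}; apply/strongly_semiprime_annC.
move=> z nz Zz; have [a [La na]] := ((essP L).1 eL).2 z nz.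
apply: na; apply: s0 => x xs; apply: sL => //; exact: ZR.
Qed.

(** With [K = r(P)], strong semiprimeness applied to the ideal [I] below yields finite [s] in [P]
    and [t] in [K] with [r(s)] and [r(t)] meeting in zero. The part [t] is then removed by testing
    on the essential ideal [K + r(K)]. *)
Lemma exists_finite_annihilator (E : lmodType A^c) (P : E -> Prop) :
  nonsingular_module E -> submod P ->
  exists2 s : seq E, (forall m, m \in s -> P m) &
    forall y, ess (fun a => P (y *> a)) ->
      forall a, (forall m, m \in s -> m *> a = 0) -> y *> a = 0.
Proof.
move=> nsE sP; have [P0 [PD PZ]] := sP.
pose K k := forall y, P y -> y *> k = 0.
have hK : two_sided_ideal K.
  split; last by move=> a k Kk y Py; rewrite ractM Kk //; exact: PZ.
  split; first by move=> y _; rewrite ractr0.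
  split=> [a b Ka Kb y Py|a b Ka y Py]; first by rewrite ractDr Ka ?Kb ?addr0.
  by rewrite ractM Ka ?ract0.
have [[K0 [KD KR]] KL] := hK.
pose annE (s : seq E) a := forall m, m \in s -> m *> a = 0.
pose annA (t : seq A) a := forall k, k \in t -> k * a = 0.
pose I x := exists s t, [/\ forall m, m \in s -> P m, forall k, k \in t -> K k
  & forall a, annE s a -> annA t a -> x * a = 0].
have KI k : K k -> I k.
  move=> Kk; exists [::], [:: k]; split=> // [x|a _]; first by rewrite inE => /eqP ->.
  by apply; exact: mem_head.
have hI : two_sided_ideal I.
  split; last first.
    move=> a x [s [t [sP' tK xE]]]; exists s, t; split=> // b sb tb.
    by rewrite -mulrA xE // mulr0.
  split; first exact: KI.
  split=> [x x' [s [t [sP' tK xE]]] [s' [t' [sP'' tK' xE']]]|x b [s [t [sP' tK xE]]]].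
    exists (s ++ s'), (t ++ t'); split=> [m|k|a sa ta].
    - by rewrite mem_cat => /orP[/sP'|/sP''].
    - by rewrite mem_cat => /orP[/tK|/tK'].
    rewrite mulrDl xE ?xE' ?addr0 // => k ks.
    - by apply: sa; rewrite mem_cat ks orbT.
    - by apply: ta; rewrite mem_cat ks orbT.
    - by apply: sa; rewrite mem_cat ks.
    - by apply: ta; rewrite mem_cat ks.
  exists [seq m *> b | m <- s], [seq k * b | k <- t]; split=> [m|k|a sa ta].
  - by move=> /mapP[m' /sP' Pm' ->]; exact: PZ.
  - by move=> /mapP[k' /tK Kk' ->]; exact: KR.
  rewrite -mulrA xE // => [m ms|k kt].
    by rewrite ractM; apply: sa; exact: map_f.
  by rewrite mulrA; apply: ta; exact: map_f.
have eI : ess I.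
  apply/essP; split; first by case: hI.
  move=> x nx; have [/KI Ix|/existsNP[m /not_implyP[Pm mx]]] := pselect (K x).
    by exists 1; rewrite mulr1.
  (* As [r(m x)] is not essential, some nonzero [l] has [l A] meeting it in zero. Then [m x l] and
     [l] have the same annihilator, so the single element [m x l] of [P] shows that [x l] is in
     [I]. *)
  apply: contrapT => noI; apply: (nsE _ mx); apply/essP; split.
    exact: right_ideal_rann.
  move=> l nl; apply: contrapT => nol.
  have lE b : m *> x *> l *> b = 0 -> l * b = 0.
    by move=> e; apply: contrapT => nb; apply: nol; exists b; rewrite /rann ractM.
  apply: noI; exists l; split.
    exists [:: m *> x *> l], [::]; split=> // [y|a ma _].
      by rewrite inE => /eqP ->; do 2!apply: (PZ).
    by rewrite -mulrA lE ?mulr0 //; apply: ma; exact: mem_head.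
  move=> xl; apply: nl; rewrite -(mulr1 l); apply: lE.
  by rewrite ract1 -ractM xl ractr0.
have [u [uI u0]] := sspA hI eI.
have {u uI u0 hI eI} [s [t [sP' tK stE]]] : exists s t, [/\ forall m, m \in s -> P m,
    forall k, k \in t -> K k & forall a, annE s a -> annA t a -> a = 0].
  suff [s [t [sP' tK stE]]] : exists s t, [/\ forall m, m \in s -> P m,
      forall k, k \in t -> K k &
      forall a, annE s a -> annA t a -> forall x, x \in u -> x * a = 0].
    by exists s, t; split=> // a sa ta; apply: u0; exact: stE.
  elim: u uI {u0} => [_|x u IHu uI]; first by exists [::], [::].
  have [|s [t [sP' tK stE]]] := IHu; first by move=> y yu; apply: uI; rewrite inE yu orbT.
  have [s' [t' [sP'' tK' xE]]] := uI x (mem_head _ _).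
  exists (s ++ s'), (t ++ t'); split=> [m|k|a sa ta y].
  - by rewrite mem_cat => /orP[/sP'|/sP''].
  - by rewrite mem_cat => /orP[/tK|/tK'].
  rewrite inE => /orP[/eqP ->|].
    apply: xE => m ms; first by apply: sa; rewrite mem_cat ms orbT.
    by apply: ta; rewrite mem_cat ms orbT.
  apply: stE => m ms; first by apply: sa; rewrite mem_cat ms.
  by apply: ta; rewrite mem_cat ms.
exists s => // y ey a sa.
have eKK := ess_annihilator_sum hK.
(* When [y k b] is in [P] it is killed by [K], and it is killed by [r(K)] because [k b] is in
   [K]. *)
have yK k : K k -> y *> k = 0.
  move=> Kk; apply: (nonsing_eq0 nsE (ess_colon k ey)) => b Pykb.
  apply: (nonsing_eq0 nsE eKK) => _ [k' [c [Kk' Kc ->]]].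
  by rewrite -(ractM y k) ractDr Kk' // add0r -ractM (Kc (k * b)) ?ractr0 //; exact: KR.
apply: (nonsing_eq0 nsE eKK) => _ [k [c [Kk Kc ->]]].
rewrite ractDr -ractM yK ?add0r; last exact: KL.
(* For [c] in [r(K)] the product [a c] is killed by [s] through [a] and by [t] because [K a] lies in
   [K]; hence [a c = 0]. *)
rewrite -ractM (stE (a * c)) ?ractr0 // => [m ms|k' k't]; first by rewrite ractM sa ?ract0.
by rewrite mulrA Kc //; apply: KR; exact: tK.
Qed.
End StronglySemiprime.

(** * Subrings of regular rings containing all units *)

Section UnitStableSubring.
Variables (S : pzRingType) (T : S -> Prop) (f : S).
Hypothesis S_regular : forall s : S, exists t, s * t * s = s.
Hypothesis T_unit : forall u v : S, u * v = 1 -> v * u = 1 -> T u.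
Hypothesis TB : forall u v : S, T u -> T v -> T (u - v).
Hypothesis TM : forall u v : S, T u -> T v -> T (u * v).
Hypothesis f_idem : f * f = f.
Hypothesis T_ideal0 : forall v : S, (forall u, T (u * v)) -> f * v = 0.

Lemma subring1 : T 1.
Proof. by apply: (T_unit (v := 1)); rewrite mulr1. Qed.

Lemma subringN u : T u -> T (- u).
Proof.
by move=> Tu; rewrite -sub0r; apply: TB => //; rewrite -(subrr 1); apply: TB; exact: subring1.
Qed.

Lemma subringD u v : T u -> T v -> T (u + v).
Proof. by move=> Tu Tv; rewrite -(opprK v); apply: TB => //; exact: subringN. Qed.

Lemma idem_compl (g : S) : g * g = g -> (1 - g) * (1 - g) = 1 - g.
Proof. by move=> gg; rewrite mulrBl mul1r mulrBr mulr1 gg subrr subr0. Qed.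

Lemma idem_mulC (g : S) : g * g = g -> g * (1 - g) = 0.
Proof. by move=> gg; rewrite mulrBr mulr1 gg subrr. Qed.

Lemma idem_mulCl (g : S) : g * g = g -> (1 - g) * g = 0.
Proof. by move=> gg; rewrite mulrBl mul1r gg subrr. Qed.

(** The element [w = g v (1 - g)] has square zero, so [1 + w] is a unit with inverse [1 - w]. *)
Lemma subring_corner g v : g * g = g -> T (g * v * (1 - g)).
Proof.
move=> gg; set w := _ * _ * _.
have ww : w * w = 0.
  by rewrite /w -!mulrA (mulrA (1 - g) g) idem_mulCl // !mul0r !mulr0.
have Tw : T (1 + w).
  apply: (T_unit (v := 1 - w)).
    by rewrite mulrDl mul1r mulrBr mulr1 ww subr0 subrK.
  by rewrite mulrBl mul1r mulrDr mulr1 ww addr0 addrK.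
by rewrite -[w](addKr 1) addrC; apply: TB => //; exact: subring1.
Qed.

(** With [w = g v (1 - g)], write [u w = g u w + ((1 - g) u g) w]: an element of one corner plus a
    product of elements of opposite corners. *)
Lemma subring_corner_left g u v : g * g = g -> T (u * (g * v * (1 - g))).
Proof.
move=> gg; set w := g * v * (1 - g).
have -> : u * w = g * (u * (g * v)) * (1 - g) + (1 - g) * u * (1 - (1 - g)) * w.
  have -> : 1 - (1 - g) = g by rewrite opprB addrCA subrr addr0.
  have gw : g * w = w by rewrite /w !mulrA gg.
  have -> : g * (u * (g * v)) * (1 - g) = g * (u * w) by rewrite /w !mulrA.
  by rewrite -(mulrA _ g) gw -(mulrA _ u) -mulrDl addrC subrK mul1r.
apply: subringD; first exact: subring_corner.
apply: TM; last exact: subring_corner.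
by apply: subring_corner; exact: idem_compl.
Qed.

Lemma idem_corner g s : g * g = g -> f * (g * s * (1 - g)) = 0.
Proof. by move=> gg; apply: T_ideal0 => u; exact: subring_corner_left. Qed.

(* Modulo the annihilator of [f], all idempotents are central. *)
Lemma idem_central g s : g * g = g -> f * s * g = f * g * s.
Proof.
move=> gg; have := idem_corner s gg; have := idem_corner s (idem_compl gg).
have -> : 1 - (1 - g) = g by rewrite opprB addrCA subrr addr0.
rewrite !mulrBl mulrBr mul1r mulrBr mulr1 mulrBr !mulrA.
by move=> /eqP; rewrite subr_eq0 => /eqP -> /eqP; rewrite subr_eq0 => /eqP <-.
Qed.

(** The case [g = f] of [idem_central]; it makes [f S] a ring with identity [f]. *)
Lemma corner_absorb s : f * s * f = f * s.
Proof. by rewrite idem_central // f_idem. Qed.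

Lemma corner_id x : f * x = x -> x * f = x.
Proof. by move=> fx; rewrite -{1}fx corner_absorb. Qed.

Lemma corner_comm g x : g * g = g -> f * g = g -> f * x = x -> x * g = g * x.
Proof. by move=> gg fg fx; rewrite -{1}fx idem_central // fg. Qed.

(** Strong regularity of [f S]: for a quasi-inverse [t1], the idempotents [x t1] and [t1 x] are
    central in [f S] and therefore coincide. Thus [x] is a unit of the corner [g S]. *)
Lemma corner_supp x : f * x = x -> exists t g,
  [/\ f * t = t, g * g = g, f * g = g, x * t = g &
      [/\ t * x = g, g * x = x & g * t = t]].
Proof.
move=> fx; have [t0 xtx] := S_regular x; have xf := corner_id fx.
have [t1 [ft1 {}xtx]] : exists t1, f * t1 = t1 /\ x * t1 * x = x.
  by exists (f * t0); rewrite !mulrA f_idem xf.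
pose g := x * t1; pose g' := t1 * x.
have gg : g * g = g by rewrite /g mulrA xtx.
have g'g' : g' * g' = g' by rewrite /g' -mulrA (mulrA x) xtx.
have fg : f * g = g by rewrite /g mulrA fx.
have fg' : f * g' = g' by rewrite /g' mulrA ft1.
have e1 : g' * g = g.
  by rewrite {1}/g mulrA -(corner_comm g'g' fg' fx) /g' mulrA xtx.
have e2 : g' * g = g'.
  by rewrite -mulrA (corner_comm gg fg fx) /g xtx.
have g'E : g' = g by rewrite -e2 e1.
(* The quasi-inverse is normalised so that it lies in the corner of [g]. *)
exists (t1 * x * t1), g; split=> //.
- by rewrite !mulrA ft1.
- by rewrite !mulrA xtx.
split; first by rewrite -(mulrA _ t1) -/g' g'g'.
  by rewrite /g xtx.
by rewrite -/g' g'E mulrA gg.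
Qed.

(** A unit [x] of the corner at [h] extends to the unit [1 - h + x] of the whole ring, with inverse
    [1 - h + h t]; subtract [1]. *)
Lemma subring_corner_unit x t h : f * x = x -> f * t = t -> f * h = h -> h * h = h ->
  x * t = h -> t * x = h -> h * x = x -> T (x - h).
Proof.
move=> fx ft fh hh xt tx hx; pose k := 1 - h; pose t1 := h * t.
have xh : x * h = x by rewrite corner_comm.
have kk : k * k = k by exact: idem_compl.
have kx : k * x = 0 by rewrite -hx mulrA idem_mulCl ?mul0r.
have xk : x * k = 0 by rewrite -xh -mulrA idem_mulC ?mulr0.
have kt : k * t1 = 0 by rewrite /t1 mulrA idem_mulCl ?mul0r.
have tk : t1 * k = 0 by rewrite /t1 -(corner_comm hh fh ft) -mulrA idem_mulC ?mulr0.
have xt1 : x * t1 = h by rewrite /t1 mulrA xh.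
have t1x : t1 * x = h by rewrite /t1 -mulrA tx.
have kh : k + h = 1 by rewrite subrK.
clearbody k t1; have Tkx : T (k + x).
  by apply: (T_unit (v := k + t1)); rewrite mulrDl !mulrDr kk ?kt ?xk ?kx ?tk addr0 add0r ?xt1 ?t1x.
have -> : x - h = k + x - 1 by rewrite -kh opprD addrACA subrr add0r.
by apply: TB => //; exact: subring1.
Qed.

(* If [z = s^2 - s] is invertible in the corner [h S], then so are [s] and [1 - s], and
   both [s - h] and [- s] lie in [T]. *)
Lemma corner_boolean s : f * s = s -> s * s = s.
Proof.
move=> fs; have sf := corner_id fs; pose z := s * s - s.
have fz : f * z = z by rewrite mulrBr mulrA fs.
have zs : z * s = s * z by rewrite mulrBr mulrBl mulrA.
have [z' [g [fz' gg fg zz' [z'z gz gz']]]] := corner_supp fz.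
have z's : z' * s = s * z'.
  rewrite -{1}gz' -(corner_comm gg fg fz') -mulrA -(corner_comm gg fg fs) -zz'.
  by rewrite (mulrA s) -zs -!mulrA (mulrA z') z'z mulrA -(corner_comm gg fg fs) -mulrA gz'.
have Th h : f * h = h -> h * h = h -> g * h = h -> T h.
  move=> fh hh gh; have hC := corner_comm hh fh.
  have hg : h * g = h by rewrite corner_comm.
  have zl : (s - f) * s = z by rewrite mulrBl fs.
  have zr : s * (s - f) = z by rewrite mulrBr sf.
  have fsf : f * (s - f) = s - f by rewrite mulrBr fs f_idem.
  have h_zz' : h * (z * z') = h by rewrite zz' hg.
  have hxh x y : f * x = x -> h * x * (h * y) = h * (x * y).
    by move=> fx; rewrite -mulrA (mulrA x) hC // !mulrA hh.
  have T1 : T (h * s - h).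
    apply: (subring_corner_unit (t := h * ((s - f) * z'))) => //.
    - by rewrite mulrA fh.
    - by rewrite mulrA fh.
    - by rewrite hxh // (mulrA s) zr.
    - by rewrite hxh ?mulrA ?fsf // -!mulrA z's (mulrA (s - f)) zl.
    - by rewrite mulrA hh.
  have T2 : T (- (h * s)).
    have -> : - (h * s) = h - h * s - h by rewrite addrAC subrr add0r.
    (* Here [(f - s) (- s) = z] provides the inverse of [h - h s]. *)
    apply: (subring_corner_unit (t := - (h * (s * z')))) => //.
    - by rewrite mulrBr mulrA fh.
    - by rewrite mulrN mulrA fh.
    - rewrite mulrN mulrBl hxh // (mulrA h h) hh -mulrBr -mulrN opprB.
      by rewrite mulrA -mulrBl.
    - have fsz : f * (s * z') = s * z' by rewrite mulrA fs.
      rewrite mulNr mulrBr hxh // -[X in _ * X - _]mulr1 hxh // mulr1 -(mulrA s) z's.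
      by rewrite -mulrBr -mulrN opprB mulrA -mulrBl.
    - by rewrite mulrBr mulrA hh.
  have -> : h = - (- (h * s) + (h * s - h)) by rewrite addKr opprK.
  by apply: subringN; apply: subringD.
(* Write [v = (v - k) + k] with [k] the support idempotent of [v], which lies below [g]. *)
have Tv v : f * v = v -> g * v = v -> T v.
  move=> fv gv; have [t [k [ft kk fk vt [tv kv _]]]] := corner_supp fv.
  rewrite -(subrK k v); apply: subringD.
    exact: (subring_corner_unit (t := t)).
  by apply: Th => //; rewrite -vt mulrA gv.
have fz0 : f * z = 0.
  apply: T_ideal0 => u; rewrite -[u * z](subrK (f * (u * z))) addrC.
  apply: subringD.
    apply: Tv; first by rewrite mulrA f_idem.
    have ffu : f * (f * u) = f * u by rewrite mulrA f_idem.
    by rewrite !mulrA -(mulrA g) -(corner_comm gg fg ffu) -mulrA gz.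
  (* The remainder outside [f S] is a corner element for the idempotent [1 - f]. *)
  have -> : u * z - f * (u * z) = (1 - f) * (u * z) * (1 - (1 - f)).
    have -> : 1 - (1 - f) = f by rewrite opprB addrCA subrr addr0.
    by rewrite -2!mulrA corner_id // mulrBl mul1r.
  by apply: subring_corner; exact: idem_compl.
by apply/eqP; rewrite -subr_eq0 -/z -fz fz0.
Qed.
End UnitStableSubring.

(** * Endomorphisms of non-singular injective modules *)

Section Endomorphisms.
Variables (A : pzRingType) (E : lmodType A^c).
Local Notation ess := (@essential_right_ideal A).

Record endo := Endo { endo_fun :> E -> E; endo_hom : is_hom endo_fun }.
HB.instance Definition _ := gen_eqMixin endo.
HB.instance Definition _ := gen_choiceMixin endo.

Lemma endoP (s t : endo) : s =1 t -> s = t.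
Proof.
case: s t => [s hs] [t ht] /funext /= st.
by case: _ / st in ht *; congr Endo; exact: Prop_irrelevance.
Qed.

Lemma hom_zero : is_hom (fun _ : E => 0 : E).
Proof. by split=> *; rewrite ?addr0 ?ract0. Qed.

Lemma hom_opp (s : endo) : is_hom (fun y => - s y).
Proof.
by split=> [x y|x a]; rewrite ?(homD (endo_hom s)) ?(homZ (endo_hom s)) ?opprD ?ractN.
Qed.

Lemma hom_add (s t : endo) : is_hom (fun y => s y + t y).
Proof.
split=> [x y|x a]; last by rewrite !(homZ (endo_hom _)) ractD.
by rewrite !(homD (endo_hom _)) addrACA.
Qed.

Lemma hom_comp (s t : endo) : is_hom (fun y => s (t y)).
Proof. by split=> [x y|x a]; rewrite ?(homD (endo_hom _)) ?(homZ (endo_hom _)). Qed.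

Lemma hom_id : is_hom (@id E).
Proof. by []. Qed.

Let add s t := Endo (hom_add s t).
Let mul s t := Endo (hom_comp s t).

Lemma endo_addA : associative add.
Proof. by move=> s t u; apply: endoP => y; exact: addrA. Qed.
Lemma endo_addC : commutative add.
Proof. by move=> s t; apply: endoP => y; exact: addrC. Qed.
Lemma endo_add0 : left_id (Endo hom_zero) add.
Proof. by move=> s; apply: endoP => y; exact: add0r. Qed.
Lemma endo_addN : left_inverse (Endo hom_zero) (fun s => Endo (hom_opp s)) add.
Proof. by move=> s; apply: endoP => y; exact: addNr. Qed.

HB.instance Definition _ :=
  GRing.isZmodule.Build endo endo_addA endo_addC endo_add0 endo_addN.

Lemma endo_mulA : associative mul.
Proof. by move=> s t u; apply: endoP. Qed.
Lemma endo_mul1 : left_id (Endo hom_id) mul.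
Proof. by move=> s; apply: endoP. Qed.
Lemma endo_mulr1 : right_id (Endo hom_id) mul.
Proof. by move=> s; apply: endoP. Qed.
Lemma endo_mulDl : left_distributive mul +%R.
Proof. by move=> s t u; apply: endoP. Qed.
Lemma endo_mulDr : right_distributive mul +%R.
Proof. by move=> s t u; apply: endoP => y; exact: (homD (endo_hom s)). Qed.

HB.instance Definition _ := GRing.Zmodule_isPzRing.Build endo
  endo_mulA endo_mul1 endo_mulr1 endo_mulDl endo_mulDr.

Lemma endoD (s t : endo) y : (s + t) y = s y + t y. Proof. by []. Qed.
Lemma endoN (s : endo) y : (- s) y = - s y. Proof. by []. Qed.
Lemma endoM (s t : endo) y : (s * t) y = s (t y). Proof. by []. Qed.

Definition fully_invariant (P : E -> Prop) := forall (s : endo) y, P y -> P (s y).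

Hypotheses (nsE : nonsingular_module E) (cE : complete E).

Lemma endo_eq_essential (P : E -> Prop) (s t : endo) :
  essential P -> (forall y, P y -> s y = t y) -> s = t.
Proof.
by move=> eP st; apply: endoP; exact: hom_eq_essential nsE (endo_hom s) (endo_hom t) eP st.
Qed.

Lemma submod_ker (s : endo) : submod (fun y => s y = 0).
Proof.
have hs := endo_hom s; split; first exact: hom0.
by split=> [x y sx sy|x a sx]; rewrite ?(homD hs) ?(homZ hs) sx ?sy ?addr0 ?ract0.
Qed.

(** On a complement [Q] of its kernel [s] is injective. Extending the inverse from [s Q] to [E]
    gives [t], and [s t s = s] holds on the essential submodule [ker s + Q]. *)
Lemma endo_regular (s : endo) : exists t, s * t * s = s.
Proof.
have hs := endo_hom s; have [Q [sQ KQ eQ]] := exists_complement (submod_ker s).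
have [Q0 [QD QZ]] := sQ.
have injQ x y : Q x -> Q y -> s x = s y -> x = y.
  move=> Qx Qy sxy; apply/eqP; rewrite -subr_eq0; apply/eqP; apply: KQ.
    by rewrite (homB hs) sxy subrr.
  exact: submodB.
have [g hg] : exists g, forall x, Q x -> g (s x) = x.
  have /choice[g hg] : forall y, exists z, forall x, Q x -> y = s x -> z = x.
    move=> y; have [[x [Qx ->]]|nx] := pselect (exists x, Q x /\ y = s x).
      by exists x => x' Qx' /injQ ->.
    by exists 0 => x Qx yx; case: nx; exists x.
  by exists g => x Qx; exact: (hg _ x).
have [|_ _ [x [Qx ->]] [y [Qy ->]]|_ a [x [Qx ->]]|h [hh hgs]] :=
    @extend_hom A E E (fun y => exists x, Q x /\ y = s x) g nsE cE.
- split; first by exists 0; rewrite (hom0 hs).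
  split=> [_ _ [x [Qx ->]] [y [Qy ->]]|_ a [x [Qx ->]]].
    by exists (x + y); rewrite (homD hs); split=> //; exact: QD.
  by exists (x *> a); rewrite (homZ hs); split=> //; exact: QZ.
- by rewrite -(homD hs) !hg //; exact: QD.
- by rewrite -(homZ hs) !hg //; exact: QZ.
exists (Endo hh); apply: (endo_eq_essential eQ) => _ [p [q [sp Qq ->]]].
rewrite !endoM (homD hs) sp add0r /= hgs ?hg //; by exists q.
Qed.

(** Extend the identity of [P] by zero on a complement; the image then lies in the closure of
    [P]. *)
Lemma exists_projection (P : E -> Prop) : submod P -> exists e : endo,
  (forall y, P y -> e y = y) /\ forall y, ess (fun a => P (e y *> a)).
Proof.
move=> sP; have [Q [sQ PQ eQ]] := exists_complement sP.
have [h [hh hP]] := @extend_hom_by0 A E E P Q id nsE cE sP sQ PQ eQ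
  (fun _ _ _ _ => erefl) (fun _ _ _ => erefl).
exists (Endo hh); split=> [y Py|y] /=.
  by rewrite -{1}(addr0 y) hP //; case: sQ.
have [P0 [PD PZ]] := sP.
apply: ess_sub (ess_preimage y eQ) _ _.
  split; first by rewrite ractr0.
  by split=> [a b|a b]; rewrite ?ractDr ?ractM; auto.
by move=> a [p [q [Pp Qq yE]]]; rewrite -(homZ hh) yE hP.
Qed.

(** By induction [y] lies in the sum of the [S m]. With [K] the annihilator of the tail,
    [m a |-> y a] for [a] in [K] is well defined and extends to an endomorphism [h]; then [y - h m]
    is killed by [K], and [h m] is in [P] by invariance. *)
Lemma invariant_span (P : E -> Prop) (s : seq E) y : submod P -> fully_invariant P ->
  (forall m, m \in s -> P m) ->
  (forall a, (forall m, m \in s -> m *> a = 0) -> y *> a = 0) -> P y.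
Proof.
move=> sP iP; have [P0 [PD PZ]] := sP; elim: s y => [|m s IHs] y sP' sy.
  by rewrite -(ract1 y) sy.
pose K a := forall m, m \in s -> m *> a = 0.
have mK a b : K a -> K b -> m *> a = m *> b -> y *> a = y *> b.
  move=> Ka Kb mab; apply/eqP; rewrite -subr_eq0; apply/eqP.
  have ractBr (x : E) : x *> (a - b) = x *> a - x *> b by exact: scalerBl.
  rewrite -ractBr; apply: sy => x; rewrite inE => /orP[/eqP ->|xs].
    by rewrite ractBr mab subrr.
  by rewrite ractBr Ka // Kb // subrr.
have [g hg] : exists g, forall a, K a -> g (m *> a) = y *> a.
  have /choice[g hg] : forall x, exists z, forall a, K a -> x = m *> a -> z = y *> a.
    move=> x; have [[a [Ka ->]]|nx] := pselect (exists a, K a /\ x = m *> a).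
      by exists (y *> a) => b Kb; exact: mK.
    by exists 0 => a Ka xa; case: nx; exists a.
  by exists g => a Ka; exact: (hg _ a).
have KD a b : K a -> K b -> K (a + b).
  by move=> Ka Kb x xs; rewrite ractDr Ka // Kb // addr0.
have KM a b : K a -> K (a * b) by move=> Ka x xs; rewrite ractM Ka // ract0.
have [|_ _ [a [Ka ->]] [b [Kb ->]]|_ b [a [Ka ->]]|h [hh hgs]] :=
    @extend_hom A E E (fun x => exists a, K a /\ x = m *> a) g nsE cE.
- split; first by exists 0; split; [move=> x _|]; rewrite ractr0.
  split=> [_ _ [a [Ka ->]] [b [Kb ->]]|_ b [a [Ka ->]]].
    by exists (a + b); rewrite ractDr; split=> //; exact: KD.
  by exists (a * b); rewrite ractM; split=> //; exact: KM.
- by rewrite -ractDr !hg // ?ractDr //; exact: KD.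
- by rewrite -ractM !hg // ?ractM //; exact: KM.
rewrite -(subrK (h m) y); apply: PD.
  apply: IHs => [x xs|a Ka]; first by apply: sP'; rewrite inE xs orbT.
  by rewrite ractB -(homZ hh) hgs ?hg ?subrr //; exists a.
by apply: (iP (Endo hh)); apply: sP'; exact: mem_head.
Qed.

Hypothesis sspA : right_strongly_semiprime A.

Lemma invariant_closed (P : E -> Prop) y : submod P -> fully_invariant P ->
  ess (fun a => P (y *> a)) -> P y.
Proof.
move=> sP iP ey; have [s sP' sy] := exists_finite_annihilator sspA nsE sP.
by apply: (invariant_span sP iP sP') => a; exact: sy.
Qed.

End Endomorphisms.

(** * Essential submodules stable under all units of the endomorphism ring *)

Section AutomorphismInvariant.
Variables (A : pzRingType) (E : lmodType A^c) (P : E -> Prop).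
Local Notation ess := (@essential_right_ideal A).
Hypotheses (sspA : right_strongly_semiprime A).
Hypotheses (nsE : nonsingular_module E) (cE : complete E) (eP : essential P).
Hypothesis P_unit : forall u v : endo E, u * v = 1 -> v * u = 1 ->
  forall y, P y -> P (u y).

Let sP : submod P := proj1 eP.

(** The largest fully invariant submodule of [E] contained in [P]. *)
Definition invariant_part y := forall s : endo E, P (s y).

Lemma submod_invariant_part : submod invariant_part.
Proof.
have [P0 [PD PZ]] := sP; split; first by move=> s; rewrite (hom0 (endo_hom s)).
split=> [x y Px Py s|x a Px s]; first by rewrite (homD (endo_hom s)); apply: PD.
by rewrite (homZ (endo_hom s)); apply: PZ.
Qed.

Lemma invariant_invariant_part : fully_invariant invariant_part.
Proof. by move=> s y Py t; have := Py (t * s). Qed.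

Lemma invariant_part_sub y : invariant_part y -> P y.
Proof. by move/(_ 1). Qed.

Lemma invariant_part_max (Q : E -> Prop) y :
  fully_invariant Q -> (forall x, Q x -> P x) -> Q y -> invariant_part y.
Proof. by move=> iQ QP Qy s; apply: QP; exact: iQ. Qed.

Lemma automorphism_invariant_full y : P y.
Proof.
have sP0 := submod_invariant_part; have iP0 := invariant_invariant_part.
have [e [eP0 e_ess]] := exists_projection nsE cE sP0.
have P0e x : invariant_part (e x) by exact: (invariant_closed nsE cE sspA sP0 iP0 (e_ess x)).
pose f : endo E := 1 - e.
have ee : e * e = e by apply: endoP => x; rewrite endoM eP0.
have ff : f * f = f by exact: idem_compl.
have fP0 x : invariant_part x -> f x = 0 by move=> /eP0 ex; rewrite /f endoD endoN ex subrr.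
pose T (s : endo E) := forall x, P x -> P (s x).
have TB s t : T s -> T t -> T (s - t).
  by move=> Ts Tt x Px; apply: submodB; [exact: sP|exact: Ts|exact: Tt].
have TM s t : T s -> T t -> T (s * t) by move=> Ts Tt x Px; apply: Ts; exact: Tt.
(* If [S v] stabilises [P], then [v P] lies in the invariant part, which [f] kills; [P] being
   essential, [f v = 0]. *)
have T0 v : (forall u, T (u * v)) -> f * v = 0.
  by move=> Tv; apply: (endo_eq_essential nsE eP) => x Px; apply: fP0 => u; exact: Tv.
have reg := endo_regular nsE cE.
have absorb := corner_absorb P_unit TB TM ff T0.
have boolean := corner_boolean reg P_unit TB TM ff T0.
have comm s t : f * s = s -> f * t = t -> s * t = t * s.
  move=> fs ft; apply: (corner_comm P_unit TB TM T0) => //; exact: boolean.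
have sf s : f * s = s -> s * f = s by move=> fs; rewrite comm.
have fid x : f x = x - e x by [].
have [f0|nf] := pselect (f = 0).
  apply: invariant_part_sub; rewrite -[y](subrK (e y)) -fid f0 add0r; exact: P0e.
have atomless s : f * s = s -> s <> 0 -> exists b, [/\ f * b = b, s * b <> 0 & s * b <> s].
  move=> fs ns; apply: contrapT => nob.
  have sb b : f * b = b -> s * b = 0 \/ s * b = s.
    by move=> fb; apply: contrapT => /not_orP[? ?]; apply: nob; exists b.
  (* For an atom [s] this [Q] is fully invariant: [f u x = s (f u) x] is either [0] or [s x = f x],
     and [u x] differs from it by an element of the invariant part. *)
  pose Q x := P x /\ s x = f x.
  have sQ : submod Q.
    have [P0 [PD PZ]] := sP; split; first by split=> //; rewrite !(hom0 (endo_hom _)).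
    split=> [u v [Pu su] [Pv sv]|u a [Pu su]].
      by split; [exact: PD|rewrite !(homD (endo_hom _)) su sv].
    by split; [exact: PZ|rewrite !(homZ (endo_hom _)) su].
  have iQ : fully_invariant Q.
    move=> u x [Px sx].
    have fux : f (u x) = s ((f * u) x).
      have ffu : f * (f * u) = f * u by rewrite mulrA ff.
      have -> : f (u x) = (f * u * s) x by rewrite endoM sx -[RHS]endoM absorb.
      by rewrite comm.
    split; last by rewrite -{1}(sf s fs) endoM fux -!endoM !mulrA boolean.
    rewrite -[u x](subrK (e (u x))) -fid; apply: (sP.2.1); last exact: invariant_part_sub.
    have ffu : f * (f * u) = f * u by rewrite mulrA ff.
    rewrite fux -endoM; have [->|->] := sb _ ffu; first by case: sP.
    by rewrite sx fid; apply: submodB => //; exact: invariant_part_sub.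
  (* The closed submodule [Q] contains [s E], so [s E] lies in the invariant part and
     [s = f s = 0]. *)
  apply: ns; apply: endoP => x; rewrite -fs endoM; apply: fP0.
  apply: (invariant_part_max (Q := Q)) => //; first by move=> z [].
  apply: (invariant_closed nsE cE sspA) => //.
  apply: ess_sub (ess_preimage (s x) eP) _ _.
    have [Q0 [QD QZ]] := sQ; split; first by rewrite ractr0.
    by split=> [a b|a b]; rewrite ?ractDr ?ractM; auto.
  move=> a Pa; split=> //; rewrite !(homZ (endo_hom _)) -!endoM fs boolean //.
(* The function [next] picks a nonzero idempotent strictly below [s]; iterating it from [f] gives
   the chain [c]. *)
have /choice[next nextP] : forall s, exists t, f * s = s -> s <> 0 ->
    [/\ f * t = t, t <> 0, t <> s & s * t = t].
  move=> s; have [[fs ns]|nfs] := pselect (f * s = s /\ s <> 0); last first.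
    by exists 0 => fs ns; case: nfs.
  have [b [fb sb0 sbs]] := atomless s fs ns.
  exists (s * b) => _ _; split=> //; first by rewrite mulrA fs.
  by rewrite mulrA boolean.
pose c n := iter n next f.
have [fc nc] : (forall n, f * c n = c n) /\ forall n, c n <> 0.
  by apply: all_and2; elim=> [//|n [fc nc]]; have [] := nextP (c n) fc nc.
have cS n : c n * c n.+1 = c n.+1 by have [] := nextP (c n) (fc n) (nc n).
have c_neq n : c n.+1 <> c n by have [] := nextP (c n) (fc n) (nc n).
have c_le m n : c (m + n)%N * c m = c (m + n)%N.
  rewrite comm //; elim: n => [|n IHn]; first by rewrite addn0 boolean.
  by rewrite addnS -cS mulrA IHn.
have c_mono m n x : (m <= n)%N -> c m x = 0 -> c n x = 0.
  move=> /subnKC <- cx; by rewrite -c_le endoM cx (hom0 (endo_hom _)).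
(* As [c n = c n * f] commutes with every [f * u], its kernel is fully invariant. *)
have c_inv n : fully_invariant (fun x => c n x = 0).
  move=> u x cx; have ffu : f * (f * u) = f * u by rewrite mulrA ff.
  rewrite -(sf _ (fc n)) -endoM -mulrA comm // endoM cx.
  exact: (hom0 (endo_hom _)).
pose Q x := exists n, c n x = 0.
have sQ : submod Q.
  split; first by exists 0%N; rewrite (hom0 (endo_hom _)).
  split=> [u v [m cu] [n cv]|u a [n cu]]; last first.
    by exists n; rewrite (homZ (endo_hom _)) cu ract0.
  exists (maxn m n); rewrite (homD (endo_hom _)) (c_mono m) ?leq_maxl //.
  by rewrite (c_mono n) ?leq_maxr ?addr0.
have [s sQ' s_ann] := exists_finite_annihilator sspA nsE sQ.
have [n cn] : exists n, forall m, m \in s -> c n m = 0.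
  elim: s sQ' {s_ann} => [|x s IHs] sQ'; first by exists 0%N.
  have [|n cn] := IHs; first by move=> m ms; apply: sQ'; rewrite inE ms orbT.
  have [m cm] := sQ' x (mem_head _ _).
  exists (maxn m n) => z; rewrite inE => /orP[/eqP ->|zs].
    by apply: c_mono cm; rewrite leq_maxl.
  by apply: c_mono (cn z zs); rewrite leq_maxr.
(* One kernel contains the finite set [s], hence all of [Q] by [invariant_span]. *)
have Qn x : Q x -> c n x = 0.
  move=> Qx; apply: (invariant_span nsE cE (submod_ker (c n)) (c_inv n) cn).
  apply: s_ann; apply: ess_sub (essT A) _ _ => [|a _]; last by apply: sQ.2.2.
  have [Q0 [QD QZ]] := sQ; split; first by rewrite ractr0.
  by split=> [a b|a b]; rewrite ?ractDr ?ractM; auto.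
(* The element [f x - c n.+1 x] is killed by [c n.+1], hence by [c n]; this forces [c n = c n.+1],
   contrary to the choice of the chain. *)
case: (c_neq n); apply: endoP => x; apply/eqP; rewrite eq_sym -subr_eq0; apply/eqP.
have <- : c n (f x - c n.+1 x) = c n x - c n.+1 x.
  by rewrite (homB (endo_hom _)) -!endoM sf // cS.
apply: Qn; exists n.+1.
by rewrite (homB (endo_hom _)) -!endoM sf // boolean // subrr.
Qed.
End AutomorphismInvariant.

(** The image of [M] in its hull is stable under units, hence is the whole hull; the inverse [j] of
    [i] carries injectivity back to [M]. *)
Lemma injective_of_strongly_semiprime (A : pzRingType) (M : lmodType A^c) :
  right_strongly_semiprime A -> nonsingular_module M ->
  automorphism_invariant M -> injective_module M.
Proof.
move=> sspA nsM aiM.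
have [E [i [hi inji ei nsE cE]]] := exists_hull (strongly_semiprime_nonsingular sspA) nsM.
have injE := complete_injective nsE cE.
have /choice[j ij] : forall y, exists x, y = i x.
  move=> y; apply: (automorphism_invariant_full sspA nsE cE ei) => u v uv vu _ [x ->].
  have hull : injective_hull i by [].
  apply: (aiM E i hull u (endo_hom u)); exists v => z.
    by rewrite -endoM vu.
  by rewrite -endoM uv.
move=> N1 N2 f g hf injf hg.
have [|h [hh hg']] := injE N1 N2 f (i \o g) hf injf.
  by split=> [x y|x a] /=; rewrite ?(homD hg) ?(homZ hg) ?(homD hi) ?(homZ hi).
exists (j \o h); split=> [|x]; last by apply: inji; rewrite /= -ij hg'.
by split=> [x y|x a]; apply: inji; rewrite /= ?(homD hi) ?(homZ hi) -!ij ?(homD hh) ?(homZ hh).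
Qed.

Theorem theorem2p7 (A : pzRingType) :
  (right_nonsingular A /\
   forall M : lmodType A^c,
     nonsingular_module M -> automorphism_invariant M -> injective_module M)
  <-> right_strongly_semiprime A.
Proof.
split=> [[nsA injA]|sspA]; first exact: strongly_semiprime_of_injective.
split; first exact: strongly_semiprime_nonsingular.
by move=> M; exact: injective_of_strongly_semiprime.
Qed.
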